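(* For each $n\ge 3$, let $k$ be chosen uniformly at random from $\mathbb{Z}_n^\times$. Then $\mathbf{E}[D(\psi_k)]=O(\log^2 n\,\log\log n)$, with an absolute implicit constant. In particular, for every such $n$ there exists $k\in\mathbb{Z}_n^\times$ with $D(\psi_k)=O(\log^2 n\,\log\log n)$.
   Context: For $k\in\mathbb{Z}_n^\times$ (the units of $\mathbb{Z}_n$), $\psi_k:\mathbb{Z}_n\to\mathbb{Z}_n$ is the permutation $\psi_k(s)=ks$. An interval of $\mathbb{Z}_n$ is any subset that is the image of an interval of consecutive integers under the projection $\mathbb{Z}\to\mathbb{Z}_n$ (wrap-around allowed). For $S,T\subseteq\mathbb{Z}_n$, $D_T(S)=\bigl|\,|S\cap T|-|S||T|/n\,\bigr|$, and for a permutation $\sigma$ of $\mathbb{Z}_n$, $D(\sigma)=\max_{I,J}D_J(\sigma(I))$ over all intervals $I,J$ of $\mathbb{Z}_n$. *)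

(* Defs.v *)
From Stdlib Require Import Reals.
From mathcomp Require Import all_boot.

Set Implicit Arguments.
Unset Strict Implicit.
Unset Printing Implicit Defensive.

Definition psi (n k : nat) (s : 'I_n) : 'I_n :=
  Ordinal (ltn_pmod (k * s) (leq_ltn_trans (leq0n s) (ltn_ord s))).

Definition itv (n : nat) (a l : nat) : {set 'I_n} :=
  [set x : 'I_n | [exists i : 'I_l, (x : nat) == (a + i) %% n]].

Local Open Scope R_scope.

Definition DT (n : nat) (T S : {set 'I_n}) : R :=
  Rabs (INR #|S :&: T| - INR #|S| * INR #|T| / INR n).

(* D(sigma) = max over intervals I, J of D_J(sigma(I)).  Every interval is
   itv n a l with a < n and l <= n (longer runs give the whole of Z_n). *)
Definition Dperm (n : nat) (sigma : 'I_n -> 'I_n) : R :=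
  \big[Rmax/0]_(a : 'I_n) \big[Rmax/0]_(l : 'I_(n.+1))
  \big[Rmax/0]_(b : 'I_n) \big[Rmax/0]_(m : 'I_(n.+1))
    DT (itv n b m) (sigma @: itv n a l).

Definition ED (n : nat) : R :=
  Rdiv (\big[Rplus/0]_(k : 'I_n | coprime k n) Dperm (@psi n k))
       (INR (totient n)).

(* Main.v *)
Require Import Defs.
From Stdlib Require Import Reals Lra.
From mathcomp Require Import all_boot all_order all_algebra cyclic Rstruct.
From mathcomp Require Import ring lra zify.

(** Expanding the indicators of the two intervals in cosines, the frequency
    [h <> 0] contributes at most [2 / |sin (pi h / n) sin (pi k h / n)|] to
    [n D(psi_k)], and [1 / |sin (pi r / n)| <= n (1 / r + 1 / (n - r)) =: w(r)].
    When [k] runs over the units, [k h] is equidistributed over the residues [j]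
    with [gcd(j, n) = gcd(h, n)], so that
      [E D(psi_k) <= (2 / n) sum_(m | n, m > 1) W_m^2 / phi(m)],
    where [W_m] is the sum of [w] over the residues of additive order [m], i.e.
    [W_m = 2 m sum_(u < m, (u, m) = 1) 1 / u].
    The products of a divisor of [m] and a residue prime to [m] are distinct
    integers of [[1, m^2]], and [m^2 <= 4 sigma(m) phi(m)]; hence
    [W_m <= 8 phi(m) H_(m^2)] with [H] the harmonic numbers. As
    [sum_(m | n) phi(m) = n], this gives [E D(psi_k) = O(log^2 n)], and
    [log log n] is bounded below by [log log 3 > 0]. *)

Set Implicit Arguments.
Unset Strict Implicit.
Unset Printing Implicit Defensive.
Import Order.TTheory GRing.Theory Num.Theory.

(** * Residues and units modulo n *)

Lemma totientE_card n : totient n = #|[set k : 'I_n | coprime k n]|.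
Proof.
rewrite totient_count_coprime big_mkord -sum1_card -big_mkcond /=.
by apply: eq_bigl => k; rewrite inE coprime_sym.
Qed.

(** Coprimality to [m] has period [m], so each of the [t] blocks contributes [totient m]. *)
Lemma count_coprime_mul m t : \sum_(0 <= u < t * m) coprime u m = t * totient m.
Proof.
elim: t => [|t IHt]; first by rewrite big_geq.
rewrite mulSnr (@big_cat_nat _ _ _ (t * m)) ?leq_addr //= IHt mulSnr; congr addn.
rewrite -{1}[t * m]add0n big_addn addnC addnK totient_count_coprime.
apply: eq_bigr => u _.
by rewrite coprime_sym -coprime_modr addnC modnMDl coprime_modr.
Qed.

Lemma coprime_primeP a b :
  0 < b -> (forall p, prime p -> p %| a -> p %| b -> False) -> coprime a b.
Proof.
move=> b_gt0 no_p; rewrite /coprime; apply: contraT => g_neq1.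
have g_gt0 : 0 < gcdn a b by rewrite gcdn_gt0 b_gt0 orbT.
have g_gt1 : 1 < gcdn a b by rewrite ltn_neqAle eq_sym g_neq1.
have := pdiv_dvd (gcdn a b); rewrite dvdn_gcd => /andP[pa pb].
by case: (no_p _ (pdiv_prime g_gt1) pa pb).
Qed.

(* The witness is r' + m * t with r' = r + m > 0 and t the part of n prime to
   r': a prime of n divides exactly one of r' and m * t. *)
Lemma unit_lift n m r : 0 < n -> m %| n -> coprime r m ->
  exists2 k, coprime k n & k = r %[mod m].
Proof.
move=> n_gt0 mn co_rm; have m_gt0 : 0 < m := dvdn_gt0 n_gt0 mn.
pose r' := r + m; have r'_gt0 : 0 < r' by rewrite addn_gt0 m_gt0 orbT.
have co_r'm : coprime r' m by rewrite -coprime_modl modnDr coprime_modl.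
pose t := n`_(\pi(r')^'); have t_gt0 : 0 < t := part_gt0 _ _.
have pt p : prime p -> p %| n -> (p %| t) = ~~ (p %| r').
  move=> pr_p pn.
  have: (p \in primes t) = (p \in [seq q <- primes n | q \in \pi(r')^']).
    by rewrite primes_part.
  rewrite mem_primes mem_filter mem_primes pr_p pn n_gt0 t_gt0 /= andbT => ->.
  by rewrite inE /= mem_primes pr_p r'_gt0.
exists (r' + m * t); last by rewrite addnC mulnC modnMDl modnDr.
apply: coprime_primeP => // p pr_p pk pn.
have [pr'|npr'] := boolP (p %| r').
  move: pk; rewrite dvdn_addr // Euclid_dvdM // (pt p) // pr' orbF => pm.
  have := dvdn_gcd p r' m; rewrite pr' pm (eqP co_r'm) dvdn1 => /eqP p1.
  by rewrite p1 in pr_p.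
by move: pk; rewrite dvdn_addl ?(negPf npr') // dvdn_mull // pt.
Qed.

Lemma modn_mul_inj n w x y : coprime w n -> (x < n) -> (y < n) ->
  w * x = w * y %[mod n] -> x = y.
Proof.
move=> co_w xn yn /eqP E; wlog le_xy : x y xn yn E / (x <= y).
  by move=> IH; case: (leqP x y) => [|/ltnW] /IH -> //; rewrite eq_sym.
move: E; rewrite eq_sym eqn_mod_dvd ?leq_mul2l ?le_xy ?orbT // -mulnBr.
rewrite Gauss_dvdr 1?coprime_sym // => E.
apply/eqP; rewrite eqn_leq le_xy -subn_eq0 /= eqn0Ngt; apply/negP => d_gt0.
have := dvdn_leq d_gt0 E; rewrite leqNgt => /negP; apply.
exact: leq_ltn_trans (leq_subr _ _) yn.
Qed.

(** Multiplication by a unit of Z_n congruent to [s / r] modulo [m] injects the first fibre into the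
    second. *)
Lemma card_unit_fiber_le n m r s : 0 < n -> m %| n -> coprime r m -> coprime s m ->
  #|[set k : 'I_n | coprime k n & k == r %[mod m]]| <=
  #|[set k : 'I_n | coprime k n & k == s %[mod m]]|.
Proof.
move=> n_gt0 mn co_r co_s.
(* Bezout gives the inverse of [r] modulo [m]; it needs [r > 0], and [r = 0] is coprime to [m] only
   when [m = 1]. *)
have [r' r'r] : exists r', r' * r = 1 %[mod m].
  have m_gt0 : 0 < m := dvdn_gt0 n_gt0 mn.
  have [r0|r_gt0] := posnP r.
    by exists 0; move: co_r; rewrite r0 /coprime gcd0n => /eqP->; rewrite !modn1.
  case: (egcdnP m r_gt0) => u v e _; exists u.
  by rewrite e (eqP co_r) modnMDl.
have co_r' : coprime r' m.
  have: coprime (r' * r) m by rewrite -coprime_modl r'r coprime_modl coprime1n.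
  by rewrite coprimeMl => /andP[].
have co_sr' : coprime (s * r') m by rewrite coprimeMl co_s.
have [w co_w wE] := unit_lift n_gt0 mn co_sr'.
pose f (k : 'I_n) : 'I_n := Ordinal (ltn_pmod (w * k) n_gt0).
have f_inj : injective f.
  move=> k1 k2 /(congr1 val) /= E; apply: val_inj.
  exact: (modn_mul_inj co_w (ltn_ord k1) (ltn_ord k2) E).
rewrite -(card_imset _ f_inj); apply/subset_leq_card/subsetP => _ /imsetP[k kP ->].
move: kP; rewrite !inE /= => /andP[co_k /eqP kr].
rewrite coprime_modl coprimeMl co_w co_k /= modn_dvdm // -modnMm wE kr modnMm.
by rewrite -mulnA -modnMmr r'r modnMmr muln1.
Qed.

(** Reduction modulo [m] splits the units of Z_n into [totient m] fibres, each at least as large as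
    the one over [r]. *)
Lemma card_unit_fiber n m r : 0 < n -> m %| n -> coprime r m ->
  #|[set k : 'I_n | coprime k n & k == r %[mod m]]| * totient m <= totient n.
Proof.
move=> n_gt0 mn co_r; have m_gt0 := dvdn_gt0 n_gt0 mn.
rewrite (totientE_card n) -[X in _ <= X]sum1_card.
pose g (k : 'I_n) : 'I_m := Ordinal (ltn_pmod k m_gt0).
rewrite (@partition_big _ _ _ _ _ _ _ g (fun s : 'I_m => coprime s m)) /=; last first.
  move=> k; rewrite inE coprime_modl => /coprime_dvdr; exact.
rewrite totientE_card mulnC -sum_nat_const.
rewrite [X in X <= _](eq_bigl (fun s : 'I_m => coprime s m)); last by move=> s; rewrite inE.
apply: leq_sum => s co_s.
apply: leq_trans (card_unit_fiber_le n_gt0 mn co_r co_s) _.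
rewrite sum1_card; apply/subset_leq_card/subsetP => k; rewrite !inE unfold_in /= inE.
move=> /andP[-> /eqP ks] /=; rewrite -val_eqE /= ks modn_small //.
Qed.

(** Any two solutions [k] agree modulo [n / gcd(h, n)], so once one solution [k0] exists they all
    lie in its unit fibre for that divisor of [n]. *)
Lemma card_unit_mul n h j : 0 < n ->
  #|[set k : 'I_n | coprime k n & k * h == j %[mod n]]| * totient (n %/ gcdn h n)
    <= totient n.
Proof.
move=> n_gt0; have g_gt0 : 0 < gcdn h n by rewrite gcdn_gt0 n_gt0 orbT.
set A := [set k | _]; have [->|[k0]] := set_0Vmem A; first by rewrite cards0.
rewrite inE => /andP[co_k0 /eqP k0j].
have mn : n %/ gcdn h n %| n by rewrite dvdn_div // dvdn_gcdr.
apply: leq_trans (card_unit_fiber n_gt0 mn (coprime_dvdr mn co_k0)).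
rewrite leq_mul2r; apply/orP; right; apply/subset_leq_card/subsetP => k.
rewrite !inE => /andP[-> /eqP kj] /=.
have: k * h = k0 * h %[mod n] by rewrite kj.
move/eqP; clear -g_gt0 n_gt0.
have nE : n = (n %/ gcdn h n) * gcdn h n by rewrite divnK ?dvdn_gcdr.
have hE : h = (h %/ gcdn h n) * gcdn h n by rewrite divnK ?dvdn_gcdl.
have co : coprime (n %/ gcdn h n) (h %/ gcdn h n).
  by rewrite /coprime -(eqn_pmul2r g_gt0) muln_gcdl -nE -hE mul1n gcdnC.
wlog le12 : k k0 / k0 <= k.
  by move=> IH; case: (leqP k0 k) => [|/ltnW] /IH // H E; rewrite eq_sym H // eq_sym.
rewrite !eqn_mod_dvd ?leq_mul2r ?le12 ?orbT // -mulnBl.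
set x := (k - k0)%N.
have -> : (n %| x * h) = (n %/ gcdn h n * gcdn h n %| x * (h %/ gcdn h n * gcdn h n)).
  by rewrite -nE -hE.
by rewrite mulnA dvdn_pmul2r // Gauss_dvdl.
Qed.

Local Open Scope ring_scope.

(** * Averaging over the units *)

(** Units are grouped by the value [j] of [k * h] modulo [n], which satisfies gcd(j, n) = gcd(h, n);
    [card_unit_mul] bounds each group. *)
Lemma sum_unit_mul (F : numFieldType) (w : nat -> F) n h :
  (0 < n)%N -> (forall j, 0 <= w j) ->
  \sum_(k < n | coprime k n) w (k * h %% n)%N <=
  (totient n)%:R / (totient (n %/ gcdn h n))%:R *
    \sum_(j < n | gcdn j n == gcdn h n) w j.
Proof.
move=> n_gt0 w_ge0.
pose g (k : 'I_n) : 'I_n := Ordinal (ltn_pmod (k * h) n_gt0).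
rewrite (@partition_big _ _ _ _ _ _ _ g (fun j : 'I_n => gcdn j n == gcdn h n)) /=;
  last first.
  by move=> k co_k; rewrite gcdn_modl gcdnC Gauss_gcdr 1?coprime_sym // gcdnC.
rewrite mulr_sumr; apply: ler_sum => j _.
rewrite (eq_bigr (fun=> w j)); last by move=> k /andP[_ /eqP <-].
rewrite sumr_const -[X in X <= _]mulr_natl; apply: ler_wpM2r => //.
have phi_gt0 : (0 < totient (n %/ gcdn h n))%N.
  by rewrite totient_gt0 (dvdn_gt0 n_gt0) // dvdn_div // dvdn_gcdr.
rewrite ler_pdivlMr ?ltr0n // -natrM ler_nat.
apply: leq_trans (card_unit_mul h j n_gt0); rewrite leq_mul2r; apply/orP; right.
apply/subset_leq_card/subsetP => k; rewrite !inE unfold_in /= => /andP[-> /=].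
by rewrite -val_eqE /= (modn_small (ltn_ord j)).
Qed.

(** After exchanging the sums, frequencies are grouped by additive order [m = n / gcd(h, n)]. The
    inner average depends on [h] only through [m], hence the square; [h > 0] means [m > 1]. *)
Lemma sum_unit_correlation (F : realFieldType) (w : nat -> F) n :
  (0 < n)%N -> (forall j, 0 <= w j) ->
  \sum_(k < n | coprime k n) \sum_(h < n | (0 < h)%N) w h * w (k * h %% n)%N <=
  (totient n)%:R * \sum_(m < n.+1 | (m %| n)%N && (1 < m)%N)
    (\sum_(j < n | (n %/ gcdn j n)%N == m) w j) ^+ 2 / (totient m)%:R.
Proof.
move=> n_gt0 w_ge0; have g_gt0 h : (0 < gcdn h n)%N by rewrite gcdn_gt0 n_gt0 orbT.
rewrite exchange_big /=.
pose W m := \sum_(j < n | (n %/ gcdn j n)%N == m) w j.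
have: \sum_(h < n | (0 < h)%N) \sum_(k < n | coprime k n) w h * w (k * h %% n)%N <=
  \sum_(h < n | (0 < h)%N) w h * ((totient n)%:R / (totient (n %/ gcdn h n))%:R *
    W (n %/ gcdn h n)%N).
  apply: ler_sum => h _; rewrite -mulr_sumr; apply: ler_wpM2l => //.
  apply: le_trans (sum_unit_mul h n_gt0 w_ge0) _.
  rewrite (eq_bigl (fun j : 'I_n => n %/ gcdn j n == n %/ gcdn h n)%N) // => j.
  apply/eqP/eqP => [-> //|E].
  have := divnK (dvdn_gcdr h n); rewrite -E -[RHS](divnK (dvdn_gcdr j n)) => /eqP.
  by rewrite eqn_pmul2l ?(dvdn_gt0 n_gt0) ?dvdn_div ?dvdn_gcdr // => /eqP->.
move/le_trans; apply.
pose q (h : 'I_n) : 'I_n.+1 := inord (n %/ gcdn h n).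
have qE (h : 'I_n) : q h = (n %/ gcdn h n)%N :> nat by rewrite inordK // ltnS leq_div.
rewrite (partition_big q (fun m : 'I_n.+1 => (m %| n)%N && (1 < m)%N)) /=; last first.
  move=> h h_gt0; rewrite qE dvdn_div ?dvdn_gcdr //=.
  rewrite ltn_divRL ?dvdn_gcdr // mul1n.
  by apply: leq_ltn_trans (ltn_ord h); rewrite dvdn_leq ?dvdn_gcdl.
rewrite mulr_sumr; apply: ler_sum => m _.
rewrite (eq_bigr (fun h : 'I_n => w h * ((totient n)%:R / (totient m)%:R * W m))); last first.
  by move=> h /andP[_ /eqP <-]; rewrite qE.
rewrite -mulr_suml -/(W m).
have W_ge0 : 0 <= W m by apply: sumr_ge0.
apply: (@le_trans _ _ (W m * ((totient n)%:R / (totient m)%:R * W m))); last first.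
  by rewrite le_eqVlt; apply/orP; left; apply/eqP; ring.
apply: ler_wpM2r; first by rewrite mulr_ge0 ?divr_ge0 ?ler0n.
rewrite [X in _ <= X]big_mkcond [X in X <= _]big_mkcond; apply: ler_sum => h _ /=.
by rewrite -val_eqE /= qE; case: ifP => [/andP[_ ->] //|_]; case: ifP.
Qed.

(** * Coprime harmonic sums *)

(** Induction on the sharper bound [3/4 - 1/N], with [N] the last index: it is an equality at
    [N = 2], and 1/(x+1)^2 <= 1/x - 1/(x+1) carries it on. *)
Lemma sum_inv_sqr_le (F : realFieldType) n :
  \sum_(2 <= j < n) (j%:R ^+ 2)^-1 <= 3 / 4 :> F.
Proof.
suff H k : \sum_(2 <= j < k.+3) (j%:R ^+ 2)^-1 <= 3 / 4 - k.+2%:R^-1 :> F.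
  have [n_le2|] := leqP n 2; first by rewrite big_geq // divr_ge0.
  case: n => [|[|[|k]]] // _.
  by apply: le_trans (H k) _; rewrite lerBlDr lerDl invr_ge0.
elim: k => [|k IHk]; first by rewrite big_nat1; lra.
rewrite big_nat_recr //=; set x : F := k.+2%:R in IHk *.
have x_gt0 : 0 < x by rewrite ltr0n.
have -> : k.+3%:R = x + 1 :> F by rewrite -natr1.
suff: ((x + 1) ^+ 2)^-1 <= x^-1 - (x + 1)^-1.
  by move=> H; apply: le_trans (lerD IHk H) _; rewrite addrA subrK.
have -> : x^-1 - (x + 1)^-1 = (x * (x + 1))^-1 by field; lra.
by rewrite lef_pV2 ?posrE; nra.
Qed.

(* Every squarefree N <= m^2 is d * u with d = gcd(N, m) and u prime to m; there
   are at least m^2 / 4 of them, since sum_(j >= 2) 1 / j^2 <= 3 / 4. *)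
Lemma sqr_le_sigma_totient m : (1 < m)%N ->
  (m ^ 2 <= 4 * \sum_(d < m.+1 | (d %| m)%N) (m %/ d) * totient m)%N.
Proof.
move=> m_gt1; have m_gt0 : (0 < m)%N by exact: ltnW.
pose M := (m ^ 2)%N.
(* Squarefreeness: for 0 < N <= m^2, a square [j ^ 2] dividing [N] has [j <= m], so the bounded
   quantifier suffices. *)
pose sf N := [forall j : 'I_m.+1, (1 < j)%N ==> ~~ (j ^ 2 %| N)%N].
(* Every [N] that is not squarefree is a multiple of some [j ^ 2] with 2 <= j <= m. *)
have count_sf : (M <= \sum_(1 <= N < M.+1) sf N + \sum_(2 <= j < m.+1) M %/ j ^ 2)%N.
  under [X in (_ <= _ + X)%N]eq_bigr => j _ do rewrite divn_count_dvd.
  rewrite exchange_big -big_split /= -{1}[M](subn0) -[X in (X <= _)%N]muln1.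
  rewrite -subSS -sum_nat_const_nat !big_nat.
  apply: leq_sum => N _; case: (boolP (sf N)) => [//|].
  case/forallPn => j; rewrite negb_imply negbK => /andP[j_gt1 jN] /=.
  rewrite (bigD1_seq (j : nat)) ?iota_uniq ?mem_index_iota ?j_gt1 ?ltn_ord //=.
  by rewrite jN.
have sf_le : (\sum_(1 <= N < M.+1) sf N <=
    \sum_(d < m.+1 | (d %| m)%N) (m %/ d) * totient m)%N.
  pose A := [set N : 'I_M.+1 | (0 < N)%N && sf N].
  pose P := [set p : 'I_m.+1 * 'I_M.+1 |
    (p.1 %| m)%N && ((p.2 < m %/ p.1 * m)%N && coprime p.2 m)].
  pose f (N : 'I_M.+1) : 'I_m.+1 * 'I_M.+1 := (inord (gcdn N m), inord (N %/ gcdn N m)).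
  have f1 N : (f N).1 = gcdn N m :> nat by rewrite inordK // ltnS dvdn_leq ?dvdn_gcdr.
  have f2 N : (f N).2 = (N %/ gcdn N m)%N :> nat.
    by rewrite inordK // (leq_ltn_trans (leq_div _ _)).
  have f_inj : injective f.
    move=> N1 N2 E; apply: val_inj => /=.
    by rewrite -(divnK (dvdn_gcdl N1 m)) -(divnK (dvdn_gcdl N2 m)) -!f2 -!f1 E.
  have cardA : (\sum_(1 <= N < M.+1) sf N)%N = #|A|.
    rewrite -sum1_card big_add1 /=.
    have -> : (\sum_(0 <= N < M) sf N.+1 = \sum_(0 <= N < M.+1 | (0 < N) && sf N) 1)%N.
      rewrite [RHS]big_mkcond [RHS]big_nat_recl //= add0n; apply: eq_bigr => N _.
    by rewrite big_mkord; apply: eq_bigl => N; rewrite inE.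
  rewrite cardA -(card_imset _ f_inj).
  have -> : (\sum_(d < m.+1 | d %| m) m %/ d * totient m = #|P|)%N.
    rewrite -sum1_card (eq_bigr (fun d : 'I_m.+1 =>
      \sum_(u < M.+1 | (u < m %/ d * m)%N && coprime u m) 1)%N); last first.
      move=> d dm; rewrite -count_coprime_mul big_mkord -big_mkcond.
      have leM : (m %/ d * m <= M.+1)%N.
        by apply: leqW; rewrite /M expnS expn1 leq_mul2r leq_div orbT.
      rewrite -(big_mkord (fun u => coprime u m) (fun=> 1%N)).
      rewrite (big_nat_widen _ _ _ _ _ leM) big_mkord.
      by apply: eq_bigl => u; rewrite andbC.
    rewrite pair_big_dep /=; apply: eq_bigl => p; by rewrite inE.
  apply/subset_leq_card/subsetP => _ /imsetP[N NA ->].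
  move: NA; rewrite !inE f1 f2 => /andP[N_gt0 /forallP sfN].
  have g_gt0 : (0 < gcdn N m)%N by rewrite gcdn_gt0 N_gt0.
  rewrite dvdn_gcdr /=.
  (* A common divisor [q] of the cofactor and [m] also divides gcd(N, m), so [q ^ 2] divides [N],
     which forces [q = 1]. *)
  have co : coprime (N %/ gcdn N m) m.
    set u := (N %/ _)%N; set q := gcdn u m.
    have qm : (q < m.+1)%N by rewrite ltnS dvdn_leq ?dvdn_gcdr.
    have q_gt0 : (0 < q)%N by rewrite gcdn_gt0 m_gt0 orbT.
    have := sfN (Ordinal qm); rewrite /= -/q.
    have -> : (q ^ 2 %| N)%N.
      rewrite -(divnK (dvdn_gcdl N m)) expnS expn1 dvdn_mul ?dvdn_gcdl //.
      rewrite dvdn_gcd dvdn_gcdr andbT (dvdn_trans (dvdn_gcdl u m)) //.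
      by rewrite dvdn_div // dvdn_gcdl.
    rewrite implybF -leqNgt => q_le1.
    by rewrite /coprime -/u -/q eqn_leq q_le1.
  (* The bound N <= m^2 gives only a weak inequality; equality would make the cofactor a multiple of
     [m > 1], although it is prime to [m]. *)
  rewrite co andbT ltn_neqAle; apply/andP; split.
    apply/eqP => E; move: co; rewrite E /coprime gcdnC -[X in gcdn X _]mul1n.
    rewrite gcdnC -muln_gcdl gcdn1 mul1n => /eqP m1; by rewrite m1 in m_gt1.
  rewrite divn_mulAC ?dvdn_gcdr //; apply: leq_div2r.
  by rewrite mulnn -ltnS.
(* Rationals are used to subtract the fraction 3/4 of [M], which leaves at least [M / 4] squarefree
   numbers. *)
have : (M%:R : rat) <= (\sum_(d < m.+1 | (d %| m)%N) (m %/ d) * totient m)%N%:R + M%:R * (3 / 4).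
  apply: le_trans (_ : _ <= (\sum_(1 <= N < M.+1) sf N + \sum_(2 <= j < m.+1) M %/ j ^ 2)%N%:R) _.
    by rewrite ler_nat.
  rewrite natrD lerD // ?ler_nat //.
  apply: le_trans (ler_wpM2l (ler0n _ M) (sum_inv_sqr_le _ m.+1)).
  rewrite natr_sum mulr_sumr !big_nat; apply: ler_sum => j /andP[j_gt1 _].
  rewrite -natrX ler_pdivlMr ?ltr0n ?expn_gt0 ?(ltnW j_gt1) // -natrM ler_nat.
  exact: leq_divM.
rewrite -/M; set X := (\sum_(d < _ | _) _)%N => H.
by rewrite -(ler_nat rat) natrM; lra.
Qed.

(* The products d * u with d dividing m and u prime to m are distinct integers
   of [1, m^2]. *)
Lemma coprime_harmonic_sigma (F : realFieldType) m : (1 < m)%N ->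
  (\sum_(u < m | coprime u m) u%:R^-1) * (\sum_(d < m.+1 | (d %| m)%N) d%:R^-1) <=
  \sum_(1 <= N < (m ^ 2).+1) N%:R^-1 :> F.
Proof.
move=> m_gt1; have m_gt0 : (0 < m)%N by exact: ltnW.
pose P := [set p : 'I_m * 'I_m.+1 | coprime p.1 m && (p.2 %| m)%N].
pose f (p : 'I_m * 'I_m.+1) : 'I_(m ^ 2).+1 := inord (p.1 * p.2).
have fE p : f p = (p.1 * p.2)%N :> nat.
  rewrite inordK // ltnS expnS expn1 leq_mul //; first exact: ltnW.
  by rewrite -ltnS.
have gt0 p : p \in P -> (0 < p.1 * p.2)%N.
  rewrite inE => /andP[co d]; rewrite muln_gt0 (dvdn_gt0 m_gt0 d) andbT lt0n.
  apply: contraTneq co => ->; rewrite /coprime gcd0n neq_ltn m_gt1 orbT //.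
have f_inj : {in P &, injective f}.
  move=> [u1 d1] [u2 d2]; rewrite !inE /= => /andP[co1 dm1] /andP[co2 dm2].
  move=> /(congr1 val); rewrite /= !fE /= => E.
  have E12 : d1 = d2 :> nat.
    apply/eqP; rewrite eqn_dvd; apply/andP; split.
      have: (d1 %| u2 * d2)%N by rewrite -E dvdn_mull.
      by rewrite Gauss_dvdr // coprime_sym (coprime_dvdr dm1).
    have: (d2 %| u1 * d1)%N by rewrite E dvdn_mull.
    by rewrite Gauss_dvdr // coprime_sym (coprime_dvdr dm2).
  have d2_gt0 := dvdn_gt0 m_gt0 dm2.
  move/eqP: E; rewrite E12 eqn_pmul2r // => /eqP E'.
  by rewrite (val_inj E12) (val_inj E').
rewrite big_distrlr /= pair_big_dep /=.
rewrite (eq_bigl (fun p => p \in P)); last by move=> p; rewrite inE.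
rewrite (eq_bigr (fun p => (f p)%:R^-1)); last by move=> p _; rewrite fE natrM invfM.
rewrite -(big_imset (fun N : 'I_(m ^ 2).+1 => N%:R^-1)) //=.
rewrite big_add1 /=.
have -> : \sum_(0 <= N < m ^ 2) N.+1%:R^-1 =
    \sum_(N < (m ^ 2).+1 | (0 < N)%N) N%:R^-1 :> F.
  rewrite -(big_mkord (fun N => 0 < N)%N (fun N => N%:R^-1)).
  by rewrite [RHS]big_mkcond [RHS]big_nat_recl //= add0r.
rewrite [X in X <= _]big_mkcond [X in _ <= X]big_mkcond; apply: ler_sum => N _.
case: ifP => [/imsetP[p pP ->]|_]; first by rewrite fE gt0.
by case: ifP; rewrite ?invr_ge0.
Qed.

(** With Q the sum of 1/d over d | m, one has sigma(m) = m Q, so [sqr_le_sigma_totient] reads m <= 4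
    phi(m) Q; [coprime_harmonic_sigma] then absorbs Q. *)
Lemma coprime_harmonic_le (F : realFieldType) m : (1 < m)%N ->
  m%:R * (\sum_(u < m | coprime u m) u%:R^-1) <=
  4 * (totient m)%:R * \sum_(1 <= N < (m ^ 2).+1) N%:R^-1 :> F.
Proof.
move=> m_gt1; have m_gt0 : (0 < m)%N by exact: ltnW.
have := coprime_harmonic_sigma F m_gt1.
set S := \sum_(u < m | _) _; set Q := \sum_(d < m.+1 | _) _; set L := \sum_(1 <= N < _) _.
move=> SQ; have S_ge0 : 0 <= S by apply: sumr_ge0 => i _; rewrite invr_ge0.
have mQ : m%:R <= 4 * (totient m)%:R * Q.
  have m_gt0' : 0 < m%:R :> F by rewrite ltr0n.
  have := sqr_le_sigma_totient m_gt1; rewrite -(ler_nat F) natrM natr_sum natrX.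
  rewrite (eq_bigr (fun d : 'I_m.+1 => (m%:R * (totient m)%:R) * d%:R^-1)); last first.
    move=> d dm; have d_neq0 : d%:R != 0 :> F by rewrite pnatr_eq0 -lt0n (dvdn_gt0 m_gt0).
    have mE : m%:R = (m %/ d)%:R * d%:R :> F by rewrite -natrM divnK.
    by rewrite natrM mE; field.
  rewrite -mulr_sumr -/Q => H; rewrite -(ler_pM2l m_gt0') -expr2.
  by apply: le_trans H _; rewrite le_eqVlt; apply/orP; left; apply/eqP; ring.
apply: le_trans (ler_wpM2r S_ge0 mQ) _.
rewrite -[X in X <= _]mulrA [X in _ * X <= _]mulrC; apply: ler_wpM2l => //.
by rewrite mulr_ge0.
Qed.

(** The residues of additive order [m] modulo [d * m] are the multiples [d * u] with [u] prime to
    [m]. *)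
Lemma sum_order_eq (F : nmodType) (g : nat -> F) d m : (0 < d)%N -> (0 < m)%N ->
  \sum_(j < d * m | (d * m %/ gcdn j (d * m))%N == m) g j =
  \sum_(u < m | coprime u m) g (d * u)%N.
Proof.
move=> d_gt0 m_gt0.
have ltM (u : 'I_m) : (d * u < d * m)%N by rewrite ltn_pmul2l.
have ltD (j : 'I_(d * m)) : (j %/ d < m)%N by rewrite ltn_divLR // [(m * d)%N]mulnC ltn_ord.
rewrite (reindex_onto (fun u => Ordinal (ltM u)) (fun j => Ordinal (ltD j))) /=.
  apply: eq_bigl => u; rewrite -val_eqE /= mulKn // eqxx andbT -muln_gcdr.
  rewrite divnMl // /coprime.
  have g_gt0 : (0 < gcdn u m)%N by rewrite gcdn_gt0 m_gt0 orbT.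
  apply/eqP/eqP => [E|->]; last by rewrite divn1.
  have := divnK (dvdn_gcdr u m); rewrite E -[RHS]muln1 => /eqP.
  by rewrite eqn_pmul2l // => /eqP.
move=> j /eqP E; apply: val_inj => /=; rewrite mulnC divnK //.
have := divnK (dvdn_gcdr j (d * m)); rewrite E mulnC => /eqP.
rewrite eqn_pmul2r // => /eqP gd.
by have := dvdn_gcdl j (d * m); rewrite gd.
Qed.

(** * The majorant of 1 / |sin| *)

(** The function w(r) of the overview, over any field: only its comparison with the sine needs the
    reals. *)
Definition hyp_weight (F : fieldType) (n r : nat) : F :=
  n%:R * (r%:R^-1 + (n - r)%:R^-1).

Lemma hyp_weight_ge0 (F : realFieldType) n r : 0 <= hyp_weight F n r.
Proof. by rewrite mulr_ge0 // addr_ge0 ?invr_ge0. Qed.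

(** The weight depends only on the ratio r / n, so the sum over residues of order [m] does not
    depend on [n]. *)
Lemma hyp_weightM (F : realFieldType) d m u : (0 < d)%N ->
  hyp_weight F (d * m) (d * u) = hyp_weight F m u.
Proof.
move=> d_gt0; rewrite /hyp_weight -mulnBr !natrM !invfM -mulrDr.
by rewrite mulrACA mulfV ?mul1r // pnatr_eq0 -lt0n.
Qed.

(** The reflection u -> m - u preserves coprimality to [m] and exchanges the two halves of the
    weight. *)
Lemma sum_hyp_weight (F : realFieldType) m : (1 < m)%N ->
  \sum_(u < m | coprime u m) hyp_weight F m u =
  2 * (m%:R * \sum_(u < m | coprime u m) u%:R^-1).
Proof.
move=> m_gt1; have m_gt0 : (0 < m)%N by exact: ltnW.
rewrite -mulr_sumr big_split /= mulrCA; congr (_ * _); rewrite mulr_natl mulr2n; congr (_ + _).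
rewrite -(big_mkord (fun u => coprime u m) (fun u => (m - u)%:R^-1)).
rewrite -(big_mkord (fun u => coprime u m) (fun u => u%:R^-1)).
(* The index 0 is not prime to [m > 1]; dropping it makes the range symmetric under the
   reflection. *)
rewrite !(big_ltn_cond m_gt0) /coprime !gcd0n !(gtn_eqF m_gt1).
rewrite big_nat_rev /= big_nat_cond [RHS]big_nat_cond.
have E u : (0 < u < m)%N -> (1 + m - u.+1 = m - u)%N by rewrite addSn.
apply: eq_big => u; last by case/andP=> /[dup] u0 /andP[_ /ltnW um] _; rewrite E // subKn.
case: (boolP (0 < u < m)%N) => //= u0; rewrite E //.
have um : (u <= m)%N by case/andP: u0 => _ /ltnW.
rewrite -[X in gcdn (m - u) X == _](subnK um) gcdnDl.
by rewrite -[X in _ = (gcdn u X == _)](subnK um) gcdnDr gcdnC.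
Qed.

(** Each order [m] contributes at most (8 phi(m) L)^2 / phi(m) = 64 phi(m) L^2, and the totients of
    the divisors of [n] add up to [n]. *)
Lemma sum_unit_hyp_weight (F : realFieldType) n : (1 < n)%N ->
  \sum_(k < n | coprime k n)
    \sum_(h < n | (0 < h)%N) hyp_weight F n h * hyp_weight F n (k * h %% n)%N <=
  (totient n)%:R * (64 * n%:R * (\sum_(1 <= N < (n ^ 2).+1) N%:R^-1) ^+ 2).
Proof.
move=> n_gt1; have n_gt0 : (0 < n)%N by exact: ltnW.
apply: le_trans (sum_unit_correlation n_gt0 (hyp_weight_ge0 F n)) _.
apply: ler_wpM2l => //; set L := \sum_(1 <= N < _) _.
have L_ge0 : 0 <= L by apply: sumr_ge0 => i _; rewrite invr_ge0.
apply: (@le_trans _ _ (\sum_(m < n.+1 | (m %| n)%N) 64 * L ^+ 2 * (totient m)%:R)); last first.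
  by rewrite -mulr_sumr -natr_sum sum_totient_dvd mulrAC.
rewrite [X in X <= _]big_mkcond [X in _ <= X]big_mkcond; apply: ler_sum => m _ /=.
case: (boolP (m %| n)%N) => //= mn; case: (boolP (1 < m)%N) => m_gt1; last first.
  by rewrite mulr_ge0 // mulr_ge0 // exprn_ge0.
have m_gt0 : (0 < m)%N by exact: ltnW.
have phi_gt0 : 0 < (totient m)%:R :> F by rewrite ltr0n totient_gt0.
have d_gt0 : (0 < n %/ m)%N by rewrite divn_gt0 // dvdn_leq.
set W := \sum_(j < n | _) _.
have WE : W = 2 * (m%:R * \sum_(u < m | coprime u m) u%:R^-1).
  (* The modulus is generalised because [n] also occurs in the index type, where it cannot simply be
     rewritten. *)
  suff H N : N = (n %/ m * m)%N ->
      \sum_(j < N | (N %/ gcdn j N)%N == m) hyp_weight F N j =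
      \sum_(u < m | coprime u m) hyp_weight F m u.
    by rewrite -sum_hyp_weight // -(H n) // divnK.
  by move=> ->; rewrite sum_order_eq //; apply: eq_bigr => u _; rewrite hyp_weightM.
have Wle : W <= 8 * ((totient m)%:R * L).
  rewrite WE; apply: (@le_trans _ _ (2 * (4 * (totient m)%:R * L))); last by lra.
  rewrite ler_wpM2l //; apply: le_trans (coprime_harmonic_le F m_gt1) _.
  rewrite ler_wpM2l ?mulr_ge0 //.
  have lemn : ((m ^ 2).+1 <= (n ^ 2).+1)%N by rewrite ltnS leq_exp2r // dvdn_leq.
  rewrite /L [X in _ <= X](@big_cat_nat _ _ _ (m ^ 2).+1) //= lerDl.
  by apply: sumr_ge0 => i _; rewrite invr_ge0.
have W_ge0 : 0 <= W by apply: sumr_ge0 => j _; exact: hyp_weight_ge0.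
rewrite ler_pdivrMr //.
apply: (@le_trans _ _ ((8 * ((totient m)%:R * L)) ^+ 2)); first by rewrite lerXn2r // nnegrE (le_trans W_ge0).
by rewrite le_eqVlt; apply/orP; left; apply/eqP; ring.
Qed.

(** * Trigonometric sums *)

(* Stdlib parses the arguments of these functions in R_scope. *)
Local Arguments sin x%_ring_scope.
Local Arguments cos x%_ring_scope.
Local Arguments ln x%_ring_scope.

(** Taylor gives sin x >= x - x^3/6, and x <= PI/2 <= 2 gives x^3 <= 4x. *)
Lemma sin_ge_third (x : R) : 0 <= x -> x <= PI / 2 -> x / 3 <= sin x.
Proof.
move=> /RleP x0 /RleP x2; apply/RleP.
have {}x0 : Rle 0 x by []; have {}x2 : Rle x (Rdiv PI 2) by [].
change (Rle (Rdiv x 3) (sin x)); have PI4 := PI_4.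
have [|H _] := pre_sin_bound x 0 x0; first by Lra.lra.
apply: Rle_trans H; rewrite /sin_approx /sin_term /=.
have x_le2 : Rle x 2 by Lra.lra.
have : Rle (Rmult (Rmult x x) x) (Rmult 4 x) by Lra.nra.
Lra.lra.
Qed.

Lemma PI_gt3 : 3 < PI.
Proof.
by apply/RltP; have := PI2_3_2; change (Rlt (3 / 2) (PI / 2) -> Rlt 3 PI)%R; Lra.lra.
Qed.

Lemma Rabs_sin_addPI (x : R) q : `|sin (x + q%:R * PI)| = `|sin x|.
Proof.
elim: q => [|q IHq]; first by rewrite mul0r addr0.
have -> : x + q.+1%:R * PI = x + q%:R * PI + PI by rewrite -natr1; ring.
by rewrite -[_ + PI]RplusE neg_sin RoppE normrN.
Qed.

(** Let [s] be the smaller of [r] and [n - r]. Then sin(PI s/n) >= PI s/(3n) >= s/n, the sine is the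
    same at [r] and at [s], and the weight is at least n/s. *)
Lemma sin_mul_hyp_weight n r : (0 < r < n)%N ->
  1 <= sin (PI * r%:R / n%:R) * hyp_weight R n r.
Proof.
case/andP=> r_gt0 r_lt_n; have n_gt0 : (0 < n)%N by apply: ltn_trans r_lt_n.
have half s : (0 < s)%N -> (2 * s <= n)%N -> s%:R / n%:R <= sin (PI * s%:R / n%:R).
  move=> s_gt0 s_le.
  have n0 : 0 < n%:R :> R by rewrite ltr0n.
  have s0 : 0 < s%:R :> R by rewrite ltr0n.
  have sn : 0 < s%:R / n%:R :> R by rewrite divr_gt0.
  have sn2 : s%:R / n%:R <= 2^-1 :> R.
    by rewrite ler_pdivrMr // ler_pdivlMl // -natrM ler_nat.
  have PI3 := PI_gt3.
  rewrite -mulrA; set y := s%:R / n%:R in sn sn2 *.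
  apply: (@le_trans _ _ (PI * y / 3)); first by nra.
  by apply: sin_ge_third; nra.
have r0 : 0 < r%:R :> R by rewrite ltr0n.
have n0 : 0 < n%:R :> R by rewrite ltr0n.
have nr0 : 0 < (n - r)%:R :> R by rewrite ltr0n subn_gt0.
have key s : (0 < s)%N -> 0 < s%:R^-1 :> R -> s%:R^-1 <= r%:R^-1 + (n - r)%:R^-1 :> R ->
    s%:R / n%:R <= sin (PI * r%:R / n%:R) -> 1 <= sin (PI * r%:R / n%:R) * hyp_weight R n r.
  move=> s_gt0 si_gt0 le_inv le_sin; rewrite /hyp_weight.
  have s0 : s%:R != 0 :> R by rewrite pnatr_eq0 -lt0n.
  have E : s%:R / n%:R * (n%:R * s%:R^-1) = 1 :> R by field; rewrite s0 gt_eqF.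
  rewrite -[X in X <= _]E.
  apply: ler_pM => //; first by rewrite divr_ge0.
    by rewrite mulr_ge0 // ltW.
  by rewrite ler_pM2l.
have [le_half|gt_half] := leqP (2 * r) n.
  by apply: (key r); rewrite ?invr_gt0 // ?lerDl ?invr_ge0 //; apply: half.
apply: (key (n - r)%N); rewrite ?subn_gt0 ?invr_gt0 // ?lerDr ?invr_ge0 //.
have -> : sin (PI * r%:R / n%:R) = sin (PI * (n - r)%:R / n%:R).
  rewrite -sin_PI_x; congr sin; rewrite RminusE natrB ?(ltnW r_lt_n) //.
  by field; rewrite gt_eqF.
by apply: half; rewrite ?subn_gt0 // mulnBr leq_subLR; lia.
Qed.

Lemma Rabs_sin_mul_hyp_weight n t : ~~ (n %| t)%N -> (0 < n)%N ->
  1 <= `|sin (PI * t%:R / n%:R)| * hyp_weight R n (t %% n)%N.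
Proof.
move=> ndvd n_gt0.
have -> : `|sin (PI * t%:R / n%:R)| = `|sin (PI * (t %% n)%:R / n%:R)|.
  rewrite {1}(divn_eq t n) natrD natrM addrC mulrDr mulrDl -[RHS](Rabs_sin_addPI _ (t %/ n)).
  congr (`|sin (_ + _)|); field; by rewrite gt_eqF // ltr0n.
have rP : (0 < t %% n < n)%N by rewrite ltn_pmod // lt0n andbT.
apply: le_trans (sin_mul_hyp_weight rP) _.
by rewrite ler_wpM2r ?hyp_weight_ge0 ?ler_norm.
Qed.

(** Each term is 2 sin d cos y = sin(y + d) - sin(y - d), with [y] advancing by [2 * d]. *)
Lemma sum_cos_telescope (x d : R) l :
  2 * sin d * (\sum_(i < l) cos (x + 2 * d * i%:R)) =
  sin (x + 2 * d * l%:R - d) - sin (x - d).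
Proof.
elim: l => [|l IHl]; first by rewrite big_ord0 !mulr0 addr0 subrr.
rewrite big_ord_recr /= mulrDr IHl.
set y := x + 2 * d * l%:R.
have -> : x + 2 * d * l.+1%:R - d = y + d by rewrite /y -natr1; ring.
have -> : sin (y + d) = sin y * cos d + cos y * sin d by exact: sin_plus.
have -> : sin (y - d) = sin y * cos d - cos y * sin d by exact: sin_minus.
ring.
Qed.

Lemma normr_sin_le1 (x : R) : `|sin x| <= 1.
Proof.
rewrite ler_norml; have [/RleP H1 /RleP H2] := SIN_bound x.
by apply/andP; split.
Qed.

Lemma normr_sum_cos_le (x d : R) l : `|sin d| * `|\sum_(i < l) cos (x + 2 * d * i%:R)| <= 1.
Proof.
have := normr_sin_le1 (x + 2 * d * l%:R - d); have := normr_sin_le1 (x - d).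
set u := sin _; set v := sin _ => hu hv.
have H : `|v - u| <= 2.
  by apply: le_trans (ler_normB _ _) _; rewrite -[2]/(1 + 1) lerD.
move: H; rewrite /u /v -sum_cos_telescope !normrM (ger0_norm (ler0n R 2)); lra.
Qed.

Lemma normr_sum_sin_le (x d : R) l : `|sin d| * `|\sum_(i < l) sin (x + 2 * d * i%:R)| <= 1.
Proof.
rewrite (eq_bigr (fun i : 'I_l => cos ((x - PI / 2) + 2 * d * i%:R))).
  exact: normr_sum_cos_le.
move=> i _; set y := 2 * d * _.
have -> : x - PI / 2 + y = - (PI / 2 - (x + y)) by ring.
have -> : cos (- (PI / 2 - (x + y))) = cos (PI / 2 - (x + y)) by exact: cos_neg.
by symmetry; exact: cos_shift.
Qed.

(** The subtraction formula for the cosine separates the variables into two products of single sums,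
    each product contributing at most 1. *)
Lemma normr_sum2_cos_le (x y d e : R) l m :
  `|sin d| * `|sin e| *
  `|\sum_(i < l) \sum_(j < m) cos (x + 2 * d * i%:R - (y + 2 * e * j%:R))| <= 2.
Proof.
pose cx := \sum_(i < l) cos (x + 2 * d * i%:R).
pose sx := \sum_(i < l) sin (x + 2 * d * i%:R).
pose cy := \sum_(j < m) cos (y + 2 * e * j%:R).
pose sy := \sum_(j < m) sin (y + 2 * e * j%:R).
have -> : \sum_(i < l) \sum_(j < m) cos (x + 2 * d * i%:R - (y + 2 * e * j%:R)) =
    cx * cy + sx * sy.
  rewrite !big_distrlr -big_split /=; apply: eq_bigr => i _.
  rewrite -big_split; apply: eq_bigr => j _; exact: cos_minus.
apply: (@le_trans _ _ (`|sin d| * `|sin e| * (`|cx| * `|cy| + `|sx| * `|sy|))).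
  apply: ler_wpM2l; first by rewrite mulr_ge0.
  by apply: le_trans (ler_normD _ _) _; rewrite !normrM.
have -> : `|sin d| * `|sin e| * (`|cx| * `|cy| + `|sx| * `|sy|) =
  (`|sin d| * `|cx|) * (`|sin e| * `|cy|) + (`|sin d| * `|sx|) * (`|sin e| * `|sy|) by ring.
have -> : 2 = 1 * 1 + 1 * 1 :> R by rewrite !mul1r.
apply: lerD; apply: ler_pM; rewrite ?mulr_ge0 ?normr_ge0 //;
  by [exact: normr_sum_cos_le | exact: normr_sum_sin_le].
Qed.

Lemma cos_2PI_nat q : cos (2 * PI * q%:R) = 1.
Proof.
have := cos_period 0 q; rewrite cos_0 INRE => H; rewrite -[RHS]H; congr cos.
rewrite !RplusE !RmultE; change (2 * PI * q%:R = 0 + 2 * q%:R * PI); ring.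
Qed.

(** Off the multiples of [n], the telescoped sum with [d = PI t / n] has equal end terms by
    periodicity, while sin d is nonzero. *)
Lemma sum_cos_root n t : (0 < n)%N ->
  \sum_(h < n) cos (2 * PI * (h * t)%:R / n%:R) = (if (n %| t)%N then n%:R else 0).
Proof.
move=> n_gt0; have n_neq0 : n%:R != 0 :> R by rewrite pnatr_eq0 -lt0n.
case: ifPn => [/dvdnP[q ->]|ndvd].
  rewrite (eq_bigr (fun=> 1)) ?sumr_const ?card_ord // => h _.
  by rewrite mulnA natrM mulrA mulfK // cos_2PI_nat.
pose d := PI * t%:R / n%:R.
have sin_neq0 : sin d != 0.
  have := Rabs_sin_mul_hyp_weight ndvd n_gt0; rewrite -/d.
  by apply: contraTneq => ->; rewrite normr0 mul0r -ltNge ltr01.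
have := sum_cos_telescope 0 d n; rewrite R0E.
have -> : 0 + 2 * d * n%:R - d = 2 * PI * t%:R - d by rewrite /d; field.
have -> : sin (2 * PI * t%:R - d) = sin (0 - d).
  have := sin_period (- d) t; rewrite INRE => H; rewrite sub0r -[RHS]H; congr sin.
  rewrite !RplusE !RmultE; change (2 * PI * t%:R - d = - d + 2 * t%:R * PI); ring.
rewrite subrr => /eqP; rewrite mulf_eq0 mulf_eq0 (negPf sin_neq0) orbF pnatr_eq0 /=.
move/eqP => H; rewrite -[RHS]H; apply: eq_bigr => h _; congr cos.
by rewrite /d natrM; field.
Qed.

(** Orthogonality of characters in real form: this detects congruence modulo [n]. *)
Lemma sum_cos_eqmod n x y : (0 < n)%N ->
  \sum_(h < n) cos (2 * PI * (h * x)%:R / n%:R - 2 * PI * (h * y)%:R / n%:R) =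
  (if x == y %[mod n] then n%:R else 0).
Proof.
move=> n_gt0; wlog le_yx : x y / (y <= x)%N.
  move=> IH; case: (leqP y x) => [|/ltnW le_xy]; first exact: IH.
  rewrite eq_sym -IH //; apply: eq_bigr => h _; rewrite -opprB; exact: cos_neg.
rewrite (eqn_mod_dvd _ le_yx) -sum_cos_root //; apply: eq_bigr => h _; congr cos.
by rewrite mulnBr natrB ?leq_mul2l ?le_yx ?orbT // mulrBr mulrBl.
Qed.

(** * Discrepancy *)

Lemma psi_inj n k : coprime k n -> injective (@psi n k).
Proof.
move=> co_k x y /(congr1 val) /= E; apply: val_inj.
exact: (modn_mul_inj co_k (ltn_ord x) (ltn_ord y) E).
Qed.

(** The condition [l <= n] makes the parametrisation of the interval injective, so no point is
    repeated. *)
Lemma sum_itv (T : Type) (idx : T) (op : Monoid.com_law idx) n a l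
    (n_gt0 : (0 < n)%N) (G : 'I_n -> T) : (l <= n)%N ->
  \big[op/idx]_(x in itv n a l) G x =
  \big[op/idx]_(i < l) G (Ordinal (ltn_pmod (a + i) n_gt0)).
Proof.
move=> le_ln; pose e (i : 'I_l) : 'I_n := Ordinal (ltn_pmod (a + i) n_gt0).
have e_inj : injective e.
  move=> i j /(congr1 val) /= /eqP; rewrite eqn_modDl => /eqP E; apply: val_inj.
  by move: E; rewrite !modn_small // (leq_trans (ltn_ord _)).
rewrite -(big_imset G (in2W e_inj) (A := predT)) /=.
apply: eq_bigl => x; rewrite inE; apply/existsP/imsetP => [[i /eqP xE]|[i _ ->]].
  by exists i => //; apply: val_inj.
by exists i.
Qed.

Lemma card_itv n a l : (0 < n)%N -> (l <= n)%N -> #|itv n a l| = l.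
Proof.
by move=> n_gt0 le_ln; rewrite -sum1_card (sum_itv _ _ n_gt0) // sum1_card card_ord.
Qed.

Lemma card_psi_itv n k a l b m : (0 < n)%N -> coprime k n -> (l <= n)%N -> (m <= n)%N ->
  #|@psi n k @: itv n a l :&: itv n b m| =
  (\sum_(i < l) \sum_(j < m) (k * (a + i) == b + j %[mod n]))%N.
Proof.
move=> n_gt0 co_k le_ln le_mn.
have -> : #|@psi n k @: itv n a l :&: itv n b m| =
    (\sum_(x in itv n a l) \sum_(y in itv n b m) (psi k x == y))%N.
  rewrite -sum1_card (eq_bigl _ _ (fun x => in_setI x _ _)) big_mkcondr /= big_imset /=; last exact: in2W (psi_inj co_k).
  apply: eq_bigr => x _.
  have [Jx|Jx] := boolP (psi k x \in itv n b m).
    by rewrite (bigD1 (psi k x)) //= eqxx big1 // => y /andP[_ /negPf yx]; rewrite eq_sym yx.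
  by rewrite big1 // => y Jy; case: eqP => // E; rewrite E Jy in Jx.
rewrite (sum_itv _ _ n_gt0) //; apply: eq_bigr => i _.
rewrite (sum_itv _ _ n_gt0) //; apply: eq_bigr => j _.
by rewrite -val_eqE /= modnMmr.
Qed.

(** The incidences are expanded in cosines by [sum_cos_eqmod]. Frequency 0 gives exactly the
    expected count l m / n, and each other frequency [h] is a double sum with steps governed by
    [k * h] and [h]. *)
Lemma DT_psi_le n k a l b m : (0 < n)%N -> coprime k n -> (l <= n)%N -> (m <= n)%N ->
  DT (itv n b m) (@psi n k @: itv n a l) <=
  2 / n%:R * \sum_(h < n | (0 < h)%N) hyp_weight R n h * hyp_weight R n (k * h %% n)%N.
Proof.
move=> n_gt0 co_k le_ln le_mn; rewrite /DT RabsE RminusE RdivE RmultE !INRE.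
rewrite (card_imset _ (psi_inj co_k)) !card_itv // card_psi_itv //.
have n0 : 0 < n%:R :> R by rewrite ltr0n.
have n_neq0 : n%:R != 0 :> R by rewrite gt_eqF.
pose c h i j := cos (2 * PI * (h * (k * (a + i)))%:R / n%:R - 2 * PI * (h * (b + j))%:R / n%:R).
have -> : (\sum_(i < l) \sum_(j < m) (k * (a + i) == b + j %[mod n]))%N%:R - l%:R * m%:R / n%:R =
    n%:R^-1 * \sum_(h < n | (0 < h)%N) \sum_(i < l) \sum_(j < m) c h i j :> R.
  have -> : l%:R * m%:R / n%:R = \sum_(i < l) \sum_(j < m) n%:R^-1 :> R.
    by rewrite !sumr_const !card_ord -mulrnA -[RHS]mulr_natl natrM [l%:R * _]mulrC.
  rewrite natr_sum -sumrB exchange_big mulr_sumr /=; apply: eq_bigr => i _.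
  rewrite natr_sum -sumrB exchange_big mulr_sumr /=; apply: eq_bigr => j _.
  have := sum_cos_eqmod (k * (a + i)) (b + j) n_gt0.
  rewrite (bigD1 (Ordinal n_gt0)) //= !mul0n mulr0 !mul0r subrr cos_0 R1E.
  rewrite (eq_bigl (fun h : 'I_n => 0 < h)%N); last by move=> h; rewrite -val_eqE /= lt0n.
  rewrite -/(c _ i j); set s := \sum_(h < n | _) _ => E.
  have {E} -> : s = (if k * (a + i) == b + j %[mod n] then n%:R else 0) - 1.
    by rewrite -E addrAC subrr add0r.
  by case: ifP => _; rewrite ?mulr1n ?mulr0n; field.
rewrite normrM ger0_norm; last by rewrite invr_ge0 ltW.
rewrite -[X in _ <= X]mulrA [X in _ <= X]mulrCA; apply: ler_wpM2l.
  by rewrite invr_ge0 ltW.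
apply: le_trans (ler_norm_sum _ _ _) _; rewrite mulr_sumr; apply: ler_sum => h h_gt0.
have hn : ~~ (n %| h)%N by rewrite gtnNdvd.
have khn : ~~ (n %| k * h)%N by rewrite Gauss_dvdr // coprime_sym.
have H1 := Rabs_sin_mul_hyp_weight hn n_gt0.
have H2 := Rabs_sin_mul_hyp_weight khn n_gt0.
(* Phases and half-steps that put [c h i j] in the form of [normr_sum2_cos_le]. *)
pose x := 2 * PI * (h * (k * a))%:R / n%:R; pose y := 2 * PI * (h * b)%:R / n%:R.
pose d := PI * (k * h)%:R / n%:R; pose e := PI * h%:R / n%:R.
have := normr_sum2_cos_le x y d e l m.
rewrite (eq_bigr (fun i : 'I_l => \sum_(j < m) c h i j)); last first.
  move=> i _; apply: eq_bigr => j _; congr cos; rewrite /x /y /d /e !mulnDr !natrD !natrM.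
  by field.
rewrite modn_small // in H1 *.
move: H1 H2; set X := `|\sum_(i < l) _|; set u := `|sin _|; set v := `|sin _|.
set p := hyp_weight _ _ _; set q := hyp_weight _ _ _ => H1 H2 H.
have p_ge0 : 0 <= p := hyp_weight_ge0 _ _ _.
have q_ge0 : 0 <= q := hyp_weight_ge0 _ _ _.
have X_ge0 : 0 <= X by apply: normr_ge0.
have H3 : 1 <= (u * p) * (v * q) by rewrite -[1]mulr1 ler_pM.
apply: (@le_trans _ _ ((u * p) * (v * q) * X)); first by rewrite -[X in X <= _]mul1r ler_wpM2r.
have -> : u * p * (v * q) * X = p * q * (v * u * X) by ring.
by rewrite [X in _ <= X]mulrC; apply: ler_wpM2l; first exact: mulr_ge0.
Qed.

(** * Harmonic numbers and logarithms *)

(** This is 1 + x <= exp x at x = ln n - ln (n + 1), where exp x = 1 - 1/(n + 1). *)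
Lemma inv_le_lnB n : (0 < n)%N -> n.+1%:R^-1 <= ln n.+1%:R - ln n%:R.
Proof.
move=> n_gt0.
have /RltP n0 : 0 < n%:R :> R by rewrite ltr0n.
have /RltP n1 : 0 < n.+1%:R :> R by rewrite ltr0n.
have := exp_ineq1_le (Rminus (ln n%:R) (ln n.+1%:R)).
rewrite exp_plus exp_Ropp !exp_ln //; move/RleP.
rewrite RplusE RminusE RmultE RinvE R1E.
have -> : n%:R * n.+1%:R^-1 = 1 - n.+1%:R^-1 :> R.
  by rewrite -(natr1 n); field; rewrite natr1 pnatr_eq0.
by rewrite lerD2l => H; rewrite -[X in _ <= X]opprB lerNr.
Qed.

Lemma harmonic_le_ln n : (0 < n)%N -> \sum_(1 <= N < n.+1) N%:R^-1 <= 1 + ln n%:R.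
Proof.
case: n => // n _; elim: n => [|n IHn]; first by rewrite big_nat1 invr1 ln_1 R0E addr0.
rewrite big_nat_recr //=; apply: le_trans (lerD IHn (inv_le_lnB (ltn0Sn n))) _.
set a := ln _; set b := ln _.
by have -> : 1 + a + (b - a) = 1 + b by ring.
Qed.

Lemma ln_mono (x y : R) : 0 < x -> x <= y -> ln x <= ln y.
Proof.
move=> x0; rewrite le_eqVlt => /orP[/eqP-> //|xy]; apply/ltW/RltP.
by apply: ln_increasing; apply/RltP.
Qed.

Lemma ln_ge0 (x : R) : 1 <= x -> 0 <= ln x.
Proof. by move=> x1; rewrite -R0E -ln_1; apply: ln_mono. Qed.

(* e < (6/5)^6 < 3 *)
Lemma ln3_gt1 : 1 < ln 3.
Proof.
apply/RltP; have H := exp_ineq1 (- / 6); rewrite exp_Ropp in H.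
have E0 := exp_pos (/ 6); set x := exp (/ 6) in H E0.
have x65 : Rlt x (6 / 5).
  have {}H : Rlt (5 / 6) (/ x) by apply: Rle_lt_trans (H _); Lra.lra.
  have : Rlt (5 / 6 * x) (/ x * x) by apply: Rmult_lt_compat_r.
  by rewrite Rinv_l; Lra.lra.
have x3 : Rlt (exp 1) 3.
  have -> : exp 1 = Rmult (Rmult x x) (Rmult (Rmult x x) (Rmult x x)).
    by rewrite /x -!exp_plus; congr exp; Lra.lra.
  have x2 : Rlt (Rmult x x) (36 / 25) by Lra.nra.
  have x2_gt0 : Rlt 0 (Rmult x x) by apply: Rmult_lt_0_compat.
  set y := Rmult x x in x2 x2_gt0 *.
  have : Rlt (Rmult y y) (1296 / 625) by Lra.nra.
  by Lra.nra.
rewrite -[X in Rlt X _]ln_exp; apply: ln_increasing => //; exact: exp_pos.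
Qed.

(** * The averaged bound *)

Lemma Dperm_psi_le n k : (0 < n)%N -> coprime k n ->
  Dperm (@psi n k) <=
  2 / n%:R * \sum_(h < n | (0 < h)%N) hyp_weight R n h * hyp_weight R n (k * h %% n)%N.
Proof.
move=> n_gt0 co_k; set B := _ * _.
(* Needed because the iterated maxima start from the default value 0. *)
have B_ge0 : 0 <= B.
  rewrite mulr_ge0 ?divr_ge0 //; apply: sumr_ge0 => h _.
  by rewrite mulr_ge0 ?hyp_weight_ge0.
have maxP (I : finType) (f : I -> R) :
    (forall i, f i <= B) -> \big[Rmax/R0]_i f i <= B.
  move=> fB; apply: (big_ind (fun x : R => x <= B)) => // x y /RleP xB /RleP yB.
  by apply/RleP; apply: Rmax_lub.
apply: (maxP) => a; apply: (maxP) => l; apply: (maxP) => b; apply: (maxP) => m.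
by apply: DT_psi_le; rewrite // -ltnS.
Qed.

(** The factor 128 is 2 times 64, and the harmonic number of n^2 is at most 1 + 2 ln n. *)
Lemma sum_Dperm_psi_le n : (1 < n)%N ->
  \sum_(k < n | coprime k n) Dperm (@psi n k) <=
  (totient n)%:R * (128 * (1 + 2 * ln n%:R) ^+ 2).
Proof.
move=> n_gt1; have n_gt0 : (0 < n)%N by exact: ltnW.
have n0 : 0 < n%:R :> R by rewrite ltr0n.
apply: le_trans (ler_sum _ (fun (k : 'I_n) co_k => Dperm_psi_le n_gt0 co_k)) _.
rewrite -mulr_sumr.
apply: le_trans (ler_wpM2l _ (sum_unit_hyp_weight R n_gt1)) _; first by rewrite divr_ge0.
set L := \sum_(1 <= N < _) _.
have -> : 2 / n%:R * ((totient n)%:R * (64 * n%:R * L ^+ 2)) =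
    (totient n)%:R * (128 * L ^+ 2) by field; rewrite gt_eqF.
rewrite ler_wpM2l // ler_wpM2l // lerXn2r // ?nnegrE.
- by apply: sumr_ge0 => N _; rewrite invr_ge0.
- by rewrite addr_ge0 // mulr_ge0 // ln_ge0 // ler1n.
have n2_gt0 : (0 < n ^ 2)%N by rewrite expn_gt0 n_gt0.
apply: le_trans (harmonic_le_ln n2_gt0) _; rewrite lerD2l natrX expr2.
have -> : ln (n%:R * n%:R) = ln n%:R + ln n%:R by apply: ln_mult; apply/RltP.
by rewrite mulr_natl mulr2n.
Qed.

Lemma lnln3_gt0 : 0 < ln (ln 3).
Proof.
rewrite -R0E -ln_1; apply/RltP/ln_increasing; first exact: Rlt_0_1.
exact/RltP/ln3_gt1.
Qed.

(** Since ln n >= 1, the left side is at most 128 times 9 (ln n)^2; the factor ln ln n / ln ln 3 is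
    at least 1. *)
Lemma ln_sqr_le_lnln n : (3 <= n)%N ->
  128 * (1 + 2 * ln n%:R) ^+ 2 <=
  1152 / ln (ln 3) * (ln n%:R ^+ 2 * ln (ln n%:R)) :> R.
Proof.
move=> n3; have ln3 := ln3_gt1; have lnln3 := lnln3_gt0.
have le3 : ln 3 <= ln n%:R by apply: ln_mono; rewrite ?ltr0n // ler_nat.
have lele3 : ln (ln 3) <= ln (ln n%:R).
  by apply: ln_mono => //; apply: lt_trans ln3; exact: ltr01.
set x := ln n%:R in le3 lele3 *; set y := ln x in lele3 *; set c := ln (ln 3) in lnln3 lele3 *.
have x1 : 1 <= x by apply: ltW; apply: lt_le_trans ln3 le3.
apply: (@le_trans _ _ (1152 * x ^+ 2)); first by nra.
have -> : 1152 / c * (x ^+ 2 * y) = 1152 * x ^+ 2 * (y / c) by ring.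
rewrite -[X in X <= _]mulr1; apply: ler_wpM2l; first by nra.
by rewrite ler_pdivlMr // mul1r.
Qed.

Lemma average_exists (F : realDomainType) (I : finType) (P : pred I) (f : I -> F) (B : F) :
  (0 < #|P|)%N -> \sum_(i | P i) f i <= #|P|%:R * B -> exists2 i, P i & f i <= B.
Proof.
move=> P_gt0 sum_le; have [/existsP[i /andP[Pi fi]]|] := boolP [exists i, P i && (f i <= B)].
  by exists i.
rewrite negb_exists => /forallP no; exfalso; move: sum_le; apply/negP; rewrite -ltNge.
rewrite mulr_natl -sumr_const; case/card_gt0P: P_gt0 => i0 Pi0.
apply: ltr_sum => [|i Pi]; first by apply/hasP; exists i0; rewrite ?mem_index_enum.
by have := no i; rewrite [P i]Pi /= -ltNge.
Qed.

Local Open Scope R_scope.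

Theorem mainTheorem5 :
  exists C : R, 0 < C /\
    forall n : nat, (3 <= n)%N ->
      ED n <= C * (ln (INR n) ^ 2 * ln (ln (INR n))) /\
      exists k : 'I_n, coprime k n /\
        Dperm (@psi n k) <= C * (ln (INR n) ^ 2 * ln (ln (INR n))).
Proof.
pose C := GRing.mul 1152%:R (GRing.inv (ln (ln 3%:R))).
exists C; split.
  by apply/RltP; rewrite divr_gt0 ?lnln3_gt0.
move=> n n3.
have n_gt1 : (1 < n)%N by exact: ltnW.
have phi_gt0 : (0 < totient n)%N by rewrite totient_gt0 ltnW.
set B := _ * (_ * _).
have BE : B = GRing.mul C (GRing.mul (GRing.exp (ln n%:R) 2) (ln (ln n%:R))).
  by rewrite /B !RmultE RpowE INRE.
have sum_le : (\sum_(k < n | coprime k n) Dperm (@psi n k) <= (totient n)%:R * B)%O.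
  apply: le_trans (sum_Dperm_psi_le n_gt1) _; rewrite BE.
  by apply: ler_wpM2l => //; exact: ln_sqr_le_lnln.
split.
  apply/RleP; rewrite /ED RdivE INRE ler_pdivrMr ?ltr0n // mulrC.
  exact: sum_le.
(* Some unit does no worse than the average. *)
have [||k co_k /RleP Dk] := @average_exists _ _ (fun k : 'I_n => coprime k n)
    (fun k => Dperm (@psi n k)) B.
- by move: phi_gt0; rewrite totientE_card cardsE.
- by rewrite -cardsE -totientE_card.
by exists k.
Qed.
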